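(* Let $m\geq 2$ be odd, let $V_1,\dots,V_m$ be two-dimensional vector spaces over $\mathbb{F}_2$, and let $W_k=\mathbb{F}_4\otimes_{\mathbb{F}_2}V_k$. A line $L$ of the invariant geometric line spread $\mathcal{L}$ is a generator of the invariant quadric $\mathcal{Q}(4)$ if, and only if, the intersection point $L\cap\mathrm{span}\,\mathcal{B}_m^+$ belongs to the invariant Hermitian variety $\mathcal{H}$. Otherwise that line $L$ is a bisecant of $\mathcal{Q}(4)$, whence it has no points in common with $\mathcal{Q}(2)$.
   Context: $\mathbb{P}(V)$ is the projective space of one-dimensional subspaces of $V$. $\mathbb{F}_4=\{0,1,\omega,\omega^2\}$ with $\omega^2+\omega+1=0$. We regard $V_k\subset W_k$ via $a\mapsto1\otimes a$ and identify $\mathbb{F}_4\otimes_{\mathbb{F}_2}\bigotimes_kV_k$ with $\bigotimes_kW_k$, so $\mathbb{P}(\bigotimes_kV_k)=\mathrm{PG}(2^m-1,2)\subset\mathbb{P}(\bigotimes_kW_k)=\mathrm{PG}(2^m-1,4)$. Complex conjugation $X\mapsto\overline X$ on $\bigotimes_kW_k$ is the map induced by the Frobenius $z\mapsto z^2$ on $\mathbb{F}_4$ fixing $\bigotimes_kV_k$ elementwise. A line of $\mathbb{P}(\bigotimes_kW_k)$ is real if it equals its complex-conjugate; lines of $\mathbb{P}(\bigotimes_kV_k)$ are identified with the real lines of $\mathbb{P}(\bigotimes_kW_k)$ that they span. For each $k$ fix a basis $(e_0^{(k)},e_1^{(k)})$ of $V_k$; for $i\in\{0,1\}^m$ let $E_i=e_{i_1}^{(1)}\otimes\cdots\otimes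 e_{i_m}^{(m)}$, and let $i'$ be the opposite multi-index ($i'_k\ne i_k$ for all $k$). Put $u_0^{(k)}=e_0^{(k)}+\omega e_1^{(k)}$, $u_1^{(k)}=e_0^{(k)}+\omega^2e_1^{(k)}$ and $U_i=u_{i_1}^{(1)}\otimes\cdots\otimes u_{i_m}^{(m)}$. $\mathcal{B}_m^+$ (resp. $\mathcal{B}_m^-$) is the set of points $\mathbb{F}_4U_i$ for which $i$ has an even (resp. odd) number of entries equal to $1$; spans are taken over $\mathbb{F}_4$. Invariant spread: for $m$ odd, $\mathrm{span}\,\mathcal{B}_m^+$ and $\mathrm{span}\,\mathcal{B}_m^-$ are skew complex-conjugate subspaces, and $\mathcal{L}$ is the set of all real lines meeting $\mathrm{span}\,\mathcal{B}_m^+$ (and hence also $\mathrm{span}\,\mathcal{B}_m^-$); it is a line spread of $\mathbb{P}(\bigotimes_kV_k)$, and each of its lines meets $\mathrm{span}\,\mathcal{B}_m^+$ in exactly one point. Invariant quadric: for $q\in\{2,4\}$, $\mathcal{Q}(q)$ is the quadric of $\mathrm{PG}(2^m-1,q)$ with equation $Q(X)=0$, where $Q\big(\sum_{j\in\{0,1\}^m}x_jE_j\big)=\sum_{i\in\{0,1\}^m,\,i_1=0}x_ix_{i'}$, $x_j\in\mathbb{F}_q$. A line is called a generator of $\mathcal{Q}(4)$ if it is contained in $\mathcal{Q}(4)$, and a bisecant if it meets $\mathcal{Q}(4)$ in exactly two points. Invariant Hermitian variety: each $V_k$ carries its (unique) symplectic bilinear form $[\cdot,\cdot]$, with $[e_0^{(k)},e_1^{(k)}]=1$;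 $\bigotimes_kV_k$ carries the bilinear form determined by $[a_1\otimes\cdots\otimes a_m,b_1\otimes\cdots\otimes b_m]=\prod_{k=1}^m[a_k,b_k]$, extended $\mathbb{F}_4$-bilinearly to $\bigotimes_kW_k$. Put $[X,Y]_H=[\overline X,Y]$. Then $\mathcal{H}$ is the set of points $\mathbb{F}_4X$ of $\mathbb{P}(\bigotimes_kW_k)$ with $[X,X]_H=0$. *)

(* Defs.v *)
From mathcomp Require Export all_boot all_order all_algebra.
From mathcomp Require Export sesquilinear.

Set Implicit Arguments.
Unset Strict Implicit.
Unset Printing Implicit Defensive.

Import GRing.Theory.
Local Open Scope ring_scope.

Section TensorProducts.

Variables (K : fieldType) (m : nat) (V : 'I_m -> vectType K).

(* dfwith a x is the family a with its entry number k replaced by x : V k. *)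
Definition multilinear (U : vectType K) (f : (forall k, V k) -> U) : Prop :=
  forall (a : forall k, V k) (k : 'I_m) (c : K) (x y : V k),
    f (dfwith a (c *: x + y)) = c *: f (dfwith a x) + f (dfwith a y).

Definition is_tensor_product (T : vectType K) (t : (forall k, V k) -> T) : Prop :=
  multilinear t /\
  forall (U : vectType K) (f : (forall k, V k) -> U), multilinear f ->
    exists! g : 'Hom(T, U), forall a, g (t a) = f a.

End TensorProducts.

(* (W, iota) is F (x)_{F_2} V with iota a = 1 (x) a.  In the universal
   property, being linear over the prime field F_2 amounts to being additive. *)
Definition is_scalar_extension (F : fieldType) (V : vectType 'F_2)
    (W : vectType F) (iota : {additive V -> W}) : Prop :=
  forall (U : vectType F) (f : {additive V -> U}),
    exists! g : 'Hom(W, U), forall a, g (iota a) = f a.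

(* Multi-indices: false and true stand for 0 and 1. *)
Section MultiIndices.

Variable m : nat.

Definition opposite (i : m.-tuple bool) : m.-tuple bool := map_tuple negb i.

Definition num_ones (i : m.-tuple bool) : nat := count_mem true i.

(* E i = e_{i_1}^{(1)} (x) ... (x) e_{i_m}^{(m)}, for t the map taking a family
   of vectors to its tensor product. *)
Definition pure_tensor (K : fieldType) (V : 'I_m -> vectType K) (T : vectType K)
    (t : (forall k, V k) -> T) (e : forall k, bool -> V k) (i : m.-tuple bool) : T :=
  t (fun k => e k (tnth i k)).

End MultiIndices.

(* u_0 = e_0 + omega e_1 and u_1 = e_0 + omega^2 e_1. *)
Definition u_vec (F : fieldType) (W : vectType F) (omega : F) (e : bool -> W)
    (b : bool) : W :=
  e false + (if b then omega ^+ 2 else omega) *: e true.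

(* The points of B_m^+; a subspace of T of dimension 1 is a point of P(T). *)
Definition Bplus (F : fieldType) (m : nat) (T : vectType F)
    (U : m.-tuple bool -> T) : seq {vspace T} :=
  [seq <[U i]>%VS | i <- enum {: m.-tuple bool} & ~~ odd (num_ones i)].

Definition span_points (F : fieldType) (T : vectType F) (B : seq {vspace T}) :
    {vspace T} :=
  (\sum_(P <- B) P)%VS.

(* The coordinate with index i of X in the basis E. *)
Definition coordinate (K : fieldType) (m : nat) (T : vectType K)
    (E : m.-tuple bool -> T) (i : m.-tuple bool) (X : T) : K :=
  coord (codom_tuple E) (enum_rank i) X.

(* head false i is the first entry of i, as m > 0 in all uses. *)
Definition quadratic_form (K : fieldType) (m : nat) (T : vectType K)
    (E : m.-tuple bool -> T) (X : T) : K :=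
  \sum_(i : m.-tuple bool | head false i == false)
     coordinate E i X * coordinate E (opposite i) X.

Section ProjectiveSpace.

Variables (K : fieldType) (T : vectType K).

Definition is_point (P : {vspace T}) : Prop := \dim P = 1%N.

Definition is_line (L : {vspace T}) : Prop := \dim L = 2%N.

(* P belongs to the set of points K X such that f X = 0. *)
Definition point_of_variety (f : T -> K) (P : {vspace T}) : Prop :=
  exists X : T, [/\ X != 0, P = <[X]>%VS & f X = 0].

Definition generator (f : T -> K) (L : {vspace T}) : Prop :=
  is_line L /\
  forall P, is_point P -> (P <= L)%VS -> point_of_variety f P.

Definition bisecant (f : T -> K) (L : {vspace T}) : Prop :=
  is_line L /\
  exists P1 P2 : {vspace T}, P1 <> P2 /\
    forall P, (P <= L)%VS /\ point_of_variety f P <-> P = P1 \/ P = P2.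

End ProjectiveSpace.

(* The semilinear map X |-> \overline X of T = F_4 (x) T0, where iota : T0 -> T
   is the canonical injection. *)
Definition is_conjugation (F : fieldType) (T0 : vectType 'F_2) (T : vectType F)
    (iota : T0 -> T) (conj : {additive T -> T}) : Prop :=
  (forall (c : F) (X : T), conj (c *: X) = c ^+ 2 *: conj X) /\
  (forall x : T0, conj (iota x) = iota x).

Definition real_line (F : fieldType) (T : vectType F) (conj : T -> T)
    (L : {vspace T}) : Prop :=
  is_line L /\ (forall Y : T, Y \in L <-> exists2 X, X \in L & Y = conj X).

Definition in_spread (F : fieldType) (T : vectType F) (conj : T -> T)
    (S L : {vspace T}) : Prop :=
  real_line conj L /\ (L :&: S)%VS != 0%VS.

(* Main.v *)
Require Import Defs.
From Stdlib Require Import FunctionalExtensionality.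
From mathcomp Require Import finfield ring.

Set Implicit Arguments.
Unset Strict Implicit.
Unset Printing Implicit Defensive.

Import GRing.Theory.
Local Open Scope ring_scope.

(** Put S+ for the span of B+ and B for the bilinear form on the tensor product
    of the W_k.  Let L be a line of the spread and X a nonzero vector of its
    intersection with S+.  As L is real, it contains the conjugate X' of X;
    as S+ meets its conjugate only in 0, L is spanned by X and X', and X spans
    the intersection of L and S+.  The polar form of Q is B, so

      Q (a X + b X') = a^2 Q X + b^2 Q X' + a b B (X', X) = a b H X,

    because Q vanishes on S+ and hence on the conjugate of S+.  So L lies on the
    quadric when H X = 0, and otherwise the points of the quadric on L are
    exactly those of X and X' ([generator_hyperbolic], [hyperbolic_points]).
    These two are interchanged by conjugation, so neither of them is real.

    Both facts about S+ come from Gram matrices.  For the basis E and for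
    the frame U alike, B (E i, E j) is 1 when j is the opposite of i and 0
    otherwise ([form_frame]), and conjugation maps U i to U of the opposite of i
    ([frame_conj]).  For m odd, opposite indices have different parity.  Hence B
    vanishes on S+, and with Q (U i) = 0 ([quadratic_form_frame]) so does Q
    ([quadric_plus]); on the other hand, B pairs S+ with its conjugate
    nondegenerately, so that their intersection is 0 ([plus_conj_nondegenerate]).

    The same Gram matrix shows that E is free ([gram_free]), and U, hence S+ and
    its conjugate, lie in the span of E by mere multilinearity.  The universal
    property enters over F_2: it makes the pure tensors of basis vectors span
    ([tensor_product_span]), which gives the coordinates of a real point. *)

(** * Multilinear maps and tensor products *)

Section Multilinear.

Variables (K : fieldType) (m : nat) (V : 'I_m -> vectType K) (T : vectType K).
Variable f : (forall k, V k) -> T.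
Hypothesis f_mul : multilinear f.

Lemma multilinear0 a k : f (dfwith a (0 : V k)) = 0.
Proof.
have := f_mul a 1 (0 : V k) 0; rewrite !scale1r addr0.
by rewrite -{1}[f _]addr0 => /addrI/esym.
Qed.

Lemma multilinear_comb a k c d (x y : V k) :
  f (dfwith a (c *: x + d *: y)) = c *: f (dfwith a x) + d *: f (dfwith a y).
Proof.
rewrite f_mul; congr (_ + _).
by rewrite -[d *: y]addr0 f_mul multilinear0 addr0.
Qed.

(** Both sides are linear in each function c k.  Splitting c k into multiples of
    the two indicator functions of bool, one k at a time, reduces the identity
    to the case where every c k is such an indicator, and then the sum on the
    right has a single nonzero term. *)
Lemma multilinear_expand (c : 'I_m -> bool -> K) (e : forall k, bool -> V k) :
  f (fun k => c k false *: e k false + c k true *: e k true) =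
  \sum_(i : m.-tuple bool)
    (\prod_k c k (tnth i k)) *: f (fun k => e k (tnth i k)).
Proof.
pose lhs (c : 'I_m -> bool -> K) :=
  f (fun k => c k false *: e k false + c k true *: e k true).
pose rhs (c : 'I_m -> bool -> K) := \sum_(i : m.-tuple bool)
    (\prod_k c k (tnth i k)) *: f (fun k => e k (tnth i k)).
(* c with its entry number k replaced by the indicator function of b. *)
pose subst_at (c : 'I_m -> bool -> K) (k : 'I_m) (b : bool) : 'I_m -> bool -> K :=
  fun j b' => if j == k then (b' == b)%:R else c j b'.
have lhs_split d k :
  lhs d =
    d k false *: lhs (subst_at d k false) + d k true *: lhs (subst_at d k true).
  pose a j := d j false *: e j false + d j true *: e j true.
  have fam g : (forall j, j != k -> g j = a j) -> g = dfwith a (g k).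
    move=> eq_g; apply: functional_extensionality_dep => j.
    case: dfwithP => // l neq; apply: eq_g; by rewrite eq_sym.
  have subst_at_E b : lhs (subst_at d k b) = f (dfwith a (e k b)).
    rewrite /lhs; set g := fun l => _.
    rewrite (fam g) => [|j /negPf neq]; last by rewrite /g /subst_at neq.
    rewrite /g /subst_at eqxx; congr (f (dfwith a _)).
    by case: (b) => /=; rewrite scale1r scale0r ?addr0 ?add0r.
  by rewrite !subst_at_E -multilinear_comb -[_ + _]/(a k) -fam.
have rhs_split d k :
  rhs d =
    d k false *: rhs (subst_at d k false) + d k true *: rhs (subst_at d k true).
  rewrite /rhs !scaler_sumr -big_split /=; apply: eq_bigr => i _.
  have subst_at_E b : \prod_j subst_at d k b j (tnth i j) =
      (tnth i k == b)%:R * \prod_(j | j != k) d j (tnth i j).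
    rewrite (bigD1 k) //= /subst_at eqxx; congr (_ * _).
    by apply: eq_bigr => j /negPf ->.
  rewrite !subst_at_E (bigD1 k) //= !scalerA -scalerDl; congr (_ *: _).
  by case: (tnth i k); rewrite /= ?(mul0r, mul1r, mulr0, add0r, addr0).
(* s lists the indices that remain to be split. *)
have main (s : seq 'I_m) d :
    (forall k, k \notin s -> exists b0, forall b, d k b = (b == b0)%:R) ->
    lhs d = rhs d.
  elim: s d => [|k s IHs] d dE; last first.
    rewrite (lhs_split d k) (rhs_split d k).
    have subst_at_E b : lhs (subst_at d k b) = rhs (subst_at d k b).
      apply: IHs => j js; rewrite /subst_at; case: (eqVneq j k) => [_|neq].
        by exists b.
      by apply: dE; rewrite inE negb_or neq.
    by rewrite !subst_at_E.
  pose g : m.-tuple bool := [tuple d k true == 1 | k < m].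
  have {}dE k b : d k b = (b == tnth g k)%:R.
    have [//|b0 E] := dE k; rewrite tnth_mktuple !E.
    by case: b0 {E} => /=; rewrite ?eqxx // [0 == 1]eq_sym oner_eq0.
  rewrite /rhs (bigD1 g) //= big1 => [|k _]; last by rewrite dE eqxx.
  rewrite scale1r big1 ?addr0 => [|i neq].
    rewrite /lhs; congr f; apply: functional_extensionality_dep => k.
    by rewrite !dE; case: (tnth g k);
      rewrite /= scale1r scale0r ?addr0 ?add0r.
  have [k neqk] : exists k, tnth i k != tnth g k.
    apply/existsP; apply: contraNT neq; rewrite negb_exists => /forallP eq_ig.
    by apply/eqP/eq_from_tnth => k; apply/eqP; rewrite -[_ == _]negbK.
  by rewrite (bigD1 k) //= dE (negPf neqk) mul0r scale0r.
apply: (main (enum 'I_m)) => k; by rewrite mem_enum.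
Qed.

End Multilinear.

(** * Coordinates in a family of pure tensors *)

Section Coordinates.

Variables (K : fieldType) (m : nat) (T : vectType K).
Variable E : m.-tuple bool -> T.

Lemma memv_family i : E i \in <<codom_tuple E>>%VS.
Proof. by apply/memv_span/codom_f. Qed.

Lemma coordinate_expand X :
  X \in <<codom_tuple E>>%VS -> X = \sum_i coordinate E i X *: E i.
Proof.
move/coord_span=> {1}->; rewrite (reindex enum_rank) /=; last first.
  by apply/onW_bij/enum_rank_bij.
by apply: eq_bigr => i _; rewrite nth_codom enum_rankK.
Qed.

Lemma coordinate_comb i a b X Y :
  coordinate E i (a *: X + b *: Y) =
  a * coordinate E i X + b * coordinate E i Y.
Proof. by rewrite /coordinate linearD !linearZ. Qed.

Lemma coordinate_sum i (x : m.-tuple bool -> K) : free (codom_tuple E) ->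
  coordinate E i (\sum_j x j *: E j) = x i.
Proof.
move=> freeE; rewrite /coordinate linear_sum (bigD1 i) //= big1 => [|j neq].
  have -> : E i = (codom_tuple E)`_(enum_rank i) by rewrite nth_codom enum_rankK.
  by rewrite linearZ /= coord_free // eqxx mulr1 addr0.
have -> : E j = (codom_tuple E)`_(enum_rank j) by rewrite nth_codom enum_rankK.
rewrite linearZ /= coord_free // (inj_eq enum_rank_inj).
by rewrite (negPf neq) mulr0.
Qed.

End Coordinates.

(** The projection onto the span of the pure tensors of basis vectors fixes every
    t a, and so does the identity; by the uniqueness in the universal property
    they are equal. *)
Lemma tensor_product_span (K : fieldType) (m : nat) (V : 'I_m -> vectType K)
    (T : vectType K) (t : (forall k, V k) -> T) (e : forall k, bool -> V k) :
  is_tensor_product t ->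
  (forall k, basis_of {: V k} [:: e k false; e k true]) ->
  <<codom_tuple (pure_tensor t e)>>%VS = fullv.
Proof.
move=> [t_mul t_univ] e_basis; set S := span _.
have tS a : t a \in S.
  have [c cE] : exists c : 'I_m -> bool -> K,
      forall k, a k = c k false *: e k false + c k true *: e k true.
    pose c k (b : bool) :=
      coord [tuple e k false; e k true] (if b then lift ord0 ord0 else ord0) (a k).
    exists c => k; have eb := e_basis k.
    rewrite [LHS](coord_basis (X := [tuple e k false; e k true]) eb (memvf _)).
    by rewrite !big_ord_recl big_ord0 addr0.
  have -> : a = fun k => c k false *: e k false + c k true *: e k true.
    exact: functional_extensionality_dep.
  rewrite (multilinear_expand t_mul); apply: memv_suml => i _.
  exact/memvZ/memv_family.
have [g [_ g_uniq]] := t_univ T t t_mul.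
have g1 : g = \1%VF by apply: g_uniq => a; rewrite id_lfunE.
have gS : g = projv S by apply: g_uniq => a; exact: projv_id.
apply/vspaceP=> X; rewrite memvf.
by rewrite -[X]id_lfunE -g1 gS memv_proj.
Qed.

(** * Opposite multi-indices and the quadratic form *)

Section Opposite.

Variable m : nat.

Lemma oppositeK : involutive (@opposite m).
Proof. by move=> i; apply: eq_from_tnth => k; rewrite !tnth_map negbK. Qed.

Lemma tnth_opposite (i : m.-tuple bool) k : tnth (opposite i) k = ~~ tnth i k.
Proof. exact: tnth_map. Qed.

Lemma reindex_opposite (R : Type) (idx : R) (op : Monoid.com_law idx)
    (P : pred (m.-tuple bool)) (f : m.-tuple bool -> R) :
  \big[op/idx]_(i | P i) f i = \big[op/idx]_(i | P (opposite i)) f (opposite i).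
Proof. exact/reindex_inj/(inv_inj oppositeK). Qed.

Lemma head_opposite (i : m.-tuple bool) : (0 < m)%N ->
  head false (opposite i) = ~~ head false i.
Proof. by case: i => -[|b s] //= /eqP <-. Qed.

(** A sum over all indices is a sum over pairs of opposite indices, and each pair
    has exactly one member that starts with 0. *)
Lemma sum_head_opposite (R : nmodType) (f : m.-tuple bool -> R) : (0 < m)%N ->
  \sum_(i : m.-tuple bool | head false i == false) (f i + f (opposite i)) =
  \sum_i f i.
Proof.
move=> m_gt0; rewrite big_split /=.
rewrite [RHS](bigID (fun i : m.-tuple bool => head false i == false)) /=.
congr (_ + _).
rewrite [RHS]reindex_opposite; apply: eq_bigl => i.
by rewrite head_opposite //; case: (head _ _).
Qed.

(** The numbers of ones in an index and in its opposite add up to m. *)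
Lemma odd_num_ones_opposite (i : m.-tuple bool) :
  odd m -> odd (num_ones (opposite i)) = ~~ odd (num_ones i).
Proof.
move=> m_odd; have: odd (num_ones i + num_ones (opposite i))%N.
  rewrite /num_ones count_map; set p := preim _ _.
  have -> : count p i = count (predC (pred1 true)) i by apply: eq_count => -[].
  by rewrite count_predC size_tuple.
by rewrite oddD; case: (odd _); case: (odd _).
Qed.

Lemma eq_opposite (i j : m.-tuple bool) :
  (j == opposite i) = [forall k, tnth i k != tnth j k].
Proof.
apply/eqP/forallP => [-> k|neq]; first by rewrite tnth_opposite; case: (tnth i k).
apply: eq_from_tnth => k; rewrite tnth_opposite.
by have := neq k; case: (tnth i k); case: (tnth j k).
Qed.

Lemma prod_neq (R : comNzRingType) (i j : m.-tuple bool) :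
  \prod_k (tnth i k != tnth j k)%:R = (j == opposite i)%:R :> R.
Proof.
rewrite eq_opposite; case: forallP => [neq|].
  by rewrite big1 // => k _; rewrite neq.
move/forallP; rewrite negb_forall => /existsP[k /negPf eq_k].
by rewrite (bigD1 k) //= eq_k mul0r.
Qed.

End Opposite.

Lemma quadratic_form_comb (K : fieldType) (m : nat) (T : vectType K)
    (E : m.-tuple bool -> T) a b X Y : (0 < m)%N ->
  quadratic_form E (a *: X + b *: Y) =
  a ^+ 2 * quadratic_form E X + b ^+ 2 * quadratic_form E Y +
  a * b * \sum_i coordinate E i X * coordinate E (opposite i) Y.
Proof.
move=> m_gt0; rewrite -sum_head_opposite // /quadratic_form.
rewrite !big_distrr -!big_split /=.
by apply: eq_bigr => i _; rewrite !coordinate_comb oppositeK; ring.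
Qed.

(** * Families with the Gram matrix of opposite indices *)

Section GramMatrix.

Variables (K : fieldType) (m : nat) (T : vectType K) (B : {biscalar T}).
Variable E : m.-tuple bool -> T.
Hypothesis B_E : forall i j, B (E i) (E j) = (j == opposite i)%:R.

Lemma form_suml (I : finType) (P : pred I) (x : I -> K) (X : I -> T) Y :
  B (\sum_(i | P i) x i *: X i) Y = \sum_(i | P i) x i * B (X i) Y.
Proof.
by rewrite linear_sumlz; apply: eq_bigr => i _; rewrite linearZl_LR.
Qed.

Lemma form_sumr (I : finType) (P : pred I) (x : I -> K) (X : I -> T) Y :
  B Y (\sum_(i | P i) x i *: X i) = \sum_(i | P i) x i * B Y (X i).
Proof.
by rewrite linear_sumr; apply: eq_bigr => i _; rewrite linearZr_LR.
Qed.

Lemma form_sum_family (P : pred (m.-tuple bool)) x j :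
  B (\sum_(i | P i) x i *: E i) (E j) =
  if P (opposite j) then x (opposite j) else 0.
Proof.
rewrite form_suml; case: ifP => Pj; last first.
  rewrite big1 // => i Pi; rewrite B_E; case: eqVneq => [ji|_]; last exact: mulr0.
  by rewrite ji oppositeK Pi in Pj.
rewrite (bigD1 (opposite j)) //= B_E oppositeK eqxx mulr1 big1 ?addr0 //.
move=> i /andP[_ neq]; rewrite B_E; case: eqVneq => [ji|_]; last exact: mulr0.
by rewrite ji oppositeK eqxx in neq.
Qed.

(** A coefficient of a linear combination of the E i is recovered by pairing with
    the opposite member of the family. *)
Lemma gram_free : free (codom_tuple E).
Proof.
apply/freeP => x x0 i; rewrite -(enum_valK i).
have := form_sum_family predT (x \o enum_rank) (opposite (enum_val i)).
rewrite /= oppositeK => <-; rewrite -(linear0l B (E (opposite (enum_val i)))).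
congr (B _ _); rewrite -[RHS]x0 [RHS](reindex enum_rank) /=; last first.
  by apply/onW_bij/enum_rank_bij.
by apply: eq_bigr => j _; rewrite nth_codom enum_rankK.
Qed.

Lemma form_coordinate X Y :
  X \in <<codom_tuple E>>%VS -> Y \in <<codom_tuple E>>%VS ->
  B X Y = \sum_i coordinate E i X * coordinate E (opposite i) Y.
Proof.
move=> XE YE; rewrite {1}(coordinate_expand YE) form_sumr.
rewrite reindex_opposite /=; apply: eq_bigr => i _.
rewrite {1}(coordinate_expand XE) (form_sum_family predT) /= oppositeK.
by rewrite mulrC.
Qed.

Lemma quadratic_form_gram a b X Y : (0 < m)%N ->
  X \in <<codom_tuple E>>%VS -> Y \in <<codom_tuple E>>%VS ->
  quadratic_form E (a *: X + b *: Y) =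
  a ^+ 2 * quadratic_form E X + b ^+ 2 * quadratic_form E Y + a * b * B X Y.
Proof.
by move=> m_gt0 XE YE; rewrite quadratic_form_comb // form_coordinate.
Qed.

End GramMatrix.

(** * Points of a quadric on a line *)

Section HyperbolicLine.

Variables (K : fieldType) (T : vectType K) (f : T -> K).

Lemma point_span (P : {vspace T}) :
  is_point P -> exists2 X, X != 0 & P = <[X]>%VS.
Proof.
move=> dimP; have P0 : vpick P != 0 by rewrite vpick0 -dimv_eq0 dimP.
exists (vpick P) => //; apply/esym/eqP.
by rewrite eqEdim -memvE memv_pick dim_vline P0 dimP.
Qed.

Lemma eq_vline (X Y : T) : X != 0 -> <[X]>%VS = <[Y]>%VS ->
  exists2 c : K, c != 0 & X = c *: Y.
Proof.
move=> X0 XY; have: X \in <[Y]>%VS by rewrite -XY memv_line.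
case/vlineP=> c Xc; exists c => //.
by apply: contraNneq X0 => c0; rewrite Xc c0 scale0r.
Qed.

Lemma vlineZ (c : K) (X : T) : c != 0 -> <[c *: X]>%VS = <[X]>%VS.
Proof.
move=> c0; apply: subv_anti; rewrite -!memvE memvZ ?memv_line //=.
by apply/vlineP; exists c^-1; rewrite scalerA mulVf ?scale1r.
Qed.

Lemma point_of_homogeneous n X : (forall c Y, f (c *: Y) = c ^+ n * f Y) ->
  point_of_variety f <[X]>%VS <-> X != 0 /\ f X = 0.
Proof.
move=> f_hom; split=> [[Y [Y0 XY fY]]|[X0 fX]]; last by exists X.
have [c c0 Yc] := eq_vline Y0 (esym XY).
move/eqP: fY; rewrite Yc f_hom mulf_eq0 expf_eq0 (negPf c0) andbF /= => /eqP.
by split=> //; apply: contraNneq Y0 => X0; rewrite Yc X0 scaler0.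
Qed.

Variables (L : {vspace T}) (X Y : T) (h : K).
Hypotheses (X0 : X != 0) (YX : Y \notin <[X]>%VS).
Hypotheses (lineL : is_line L) (XL : X \in L) (YL : Y \in L).
Hypothesis fE : forall a b, f (a *: X + b *: Y) = a * b * h.

Lemma line_span Z : Z \in L -> exists a b, Z = a *: X + b *: Y.
Proof.
have free_YX : free [:: Y; X] by rewrite free_cons seq1_free span_seq1 YX X0.
have -> : L = (<[Y]> + <[X]>)%VS.
  apply/esym/eqP; rewrite eqEdim subv_add -!memvE XL YL lineL /=.
  by rewrite -(span_seq1 X) -span_cons (eqP free_YX).
by case/memv_addP=> _ /vlineP[b ->] [_ /vlineP[a ->] ->]; exists a, b; rewrite addrC.
Qed.

(** The point spanned by X + Y lies on the variety only if h = 0. *)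
Lemma generator_hyperbolic : generator f L <-> h = 0.
Proof.
split=> [[_ gL]|h0]; last first.
  split=> // P /point_span[Z Z0 ->{P}]; rewrite -memvE => /line_span[a [b ZE]].
  by exists Z; split=> //; rewrite ZE fE h0 mulr0.
have XY0 : X + Y != 0.
  apply: contraNneq YX => /eqP; rewrite addrC addr_eq0 => /eqP->.
  by rewrite memvN memv_line.
have [||Z [Z0 XYZ]] := gL <[X + Y]>%VS.
- by rewrite /is_point dim_vline XY0.
- by rewrite -memvE memvD.
have [c c0 ->] := eq_vline Z0 (esym XYZ); rewrite scalerDr fE => /eqP.
by rewrite !mulf_eq0 (negPf c0) => /eqP.
Qed.

Lemma hyperbolic_points : h != 0 -> forall P : {vspace T},
  (P <= L)%VS /\ point_of_variety f P <-> P = <[X]>%VS \/ P = <[Y]>%VS.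
Proof.
move=> h0 P; have Y0 : Y != 0 by apply: contraNneq YX => ->; rewrite mem0v.
split=> [[PL [Z [Z0 PZ fZ]]]|]; last first.
  case=> ->{P}; rewrite -memvE; split=> //.
    exists X; split=> //; have := fE 1 0.
    by rewrite scale1r scale0r addr0 mulr0 mul0r.
  exists Y; split=> //; have := fE 0 1.
  by rewrite scale1r scale0r add0r !mul0r.
move: PL; rewrite PZ -memvE => /line_span[a [b ZE]].
move/eqP: fZ; rewrite ZE fE !mulf_eq0 (negPf h0) orbF => /orP[] /eqP c0.
  right; rewrite c0 scale0r add0r vlineZ //.
  by apply: contraNneq Z0 => b0; rewrite ZE c0 b0 !scale0r addr0.
left; rewrite c0 scale0r addr0 vlineZ //.
by apply: contraNneq Z0 => a0; rewrite ZE c0 a0 !scale0r addr0.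
Qed.

End HyperbolicLine.

(** * The frame U over the field with four elements *)

Lemma sum_tuple_prod (R : comNzRingType) m (G : 'I_m -> bool -> R) :
  \sum_(a : m.-tuple bool) \prod_k G k (tnth a k) =
  \prod_k (G k false + G k true).
Proof.
transitivity (\prod_k \sum_b G k b); last first.
  by apply: eq_bigr => k _; rewrite big_bool addrC.
rewrite bigA_distr_bigA.
rewrite (reindex (fun a : m.-tuple bool => [ffun k => tnth a k])) /=.
  by apply: eq_bigr => a _; apply: eq_bigr => k _; rewrite ffunE.
exists (fun f : {ffun 'I_m -> bool} => [tuple f k | k < m]) => [a _|f _].
  by apply: eq_from_tnth => k; rewrite tnth_mktuple ffunE.
by apply/ffunP => k; rewrite ffunE tnth_mktuple.
Qed.

Section Frame.

Variables (F : finFieldType) (omega : F).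
Hypotheses (F4 : #|F| = 4%N) (omegaP : omega ^+ 2 + omega + 1 = 0).

Lemma pchar2 : 2%N \in [pchar F].
Proof. by apply: (@card_finPcharP F 2 2). Qed.

Lemma omega_sqr : omega ^+ 2 + omega = 1.
Proof. by move/eqP: omegaP; rewrite addr_eq0 (oppr_pchar2 pchar2) => /eqP. Qed.

Lemma exp4 (c : F) : (c ^+ 2) ^+ 2 = c.
Proof. by rewrite -exprM -[RHS]expf_card F4. Qed.

(** The coefficient of e c in u b, where u is given by [u_vec]. *)
Definition u_coef (b c : bool) : F :=
  if c then (if b then omega ^+ 2 else omega) else 1.

Variables (m : nat) (T : vectType F) (E : m.-tuple bool -> T).

Definition frame_coef (i a : m.-tuple bool) : F :=
  \prod_k u_coef (tnth i k) (tnth a k).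

(** The pure tensor U i written out in the basis E. *)
Definition frame (i : m.-tuple bool) : T := \sum_a frame_coef i a *: E a.

Lemma memv_frame i : frame i \in <<codom_tuple E>>%VS.
Proof. by apply: memv_suml => a _; apply/memvZ/memv_family. Qed.

(** Conjugation exchanges omega and omega^2, that is u_0 and u_1 in each factor. *)
Lemma frame_conj (conj : {additive T -> T}) i :
  (forall (c : F) X, conj (c *: X) = c ^+ 2 *: conj X) ->
  (forall a, conj (E a) = E a) ->
  conj (frame i) = frame (opposite i).
Proof.
move=> conjZ conjE; rewrite /frame raddf_sum; apply: eq_bigr => a _.
rewrite conjZ conjE /frame_coef -prodrXl; congr (_ *: _); apply: eq_bigr => k _.
rewrite tnth_opposite /u_coef.
by case: (tnth a k); case: (tnth i k) => //=; rewrite ?exp4 ?expr1n.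
Qed.

Section Form.

Variable B : {biscalar T}.
Hypothesis B_E : forall i j, B (E i) (E j) = (j == opposite i)%:R.

(** The sum factors into the products [u_b, u_c], which are 1 for b <> c, as
    omega^2 + omega = 1, and 0 for b = c, in characteristic 2. *)
Lemma form_frame i j : B (frame i) (frame j) = (j == opposite i)%:R.
Proof.
rewrite form_suml -prod_neq.
transitivity (\sum_a frame_coef i a * frame_coef j (opposite a)).
  apply: eq_bigr => a _; congr (_ * _).
  rewrite form_sumr (bigD1 (opposite a)) //= B_E eqxx mulr1 big1 ?addr0 //.
  by move=> b /negPf neq; rewrite B_E neq mulr0.
transitivity (\sum_(a : m.-tuple bool) \prod_k
  (u_coef (tnth i k) (tnth a k) * u_coef (tnth j k) (~~ tnth a k))).
  apply: eq_bigr => a _; rewrite -big_split /=.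
  by apply: eq_bigr => k _; rewrite tnth_opposite.
rewrite (sum_tuple_prod (fun k c =>
  u_coef (tnth i k) c * u_coef (tnth j k) (~~ c))).
apply: eq_bigr => k _; rewrite /u_coef /= mul1r mulr1.
by case: (tnth i k); case: (tnth j k) => /=;
  rewrite ?(addrr_pchar2 pchar2) // ?omega_sqr // addrC omega_sqr.
Qed.

(** The product of the coefficients with indices a and opposite a does not depend
    on a, and the 2^(m-1) equal terms cancel in characteristic 2 when m >= 2. *)
Lemma quadratic_form_frame i : (2 <= m)%N -> quadratic_form E (frame i) = 0.
Proof.
move=> m2; have m0 : (0 < m)%N := ltnW m2.
rewrite /quadratic_form.
transitivity (\sum_(a : m.-tuple bool | head false a == false)
  \prod_k u_coef (tnth i k) true).
  apply: eq_bigr => a _.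
  rewrite !(coordinate_sum _ _ (gram_free B_E)) -big_split /=.
  apply: eq_bigr => k _; rewrite tnth_opposite /u_coef.
  by case: (tnth a k); rewrite /= ?mul1r ?mulr1.
rewrite sumr_const -mulr_natr; set n := #|_|.
have n2 : (n * 2)%N = (2 ^ m.-1 * 2)%N.
  rewrite -expnSr prednK //.
  by rewrite -[in RHS]card_bool -card_tuple -sum1_card
     -(sum_head_opposite (fun=> 1%N)) // sum_nat_const.
move/eqP: n2; rewrite eqn_pmul2r // => /eqP ->.
by rewrite natrX (pcharf0 pchar2) expr0n -subn1 subn_eq0 leqNgt m2 mulr0.
Qed.

End Form.

End Frame.

(** * The span of the points with even index *)

Section PlusSpan.

Variables (F : fieldType) (m : nat) (T : vectType F) (B : {biscalar T}).
Variable U : m.-tuple bool -> T.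
Hypothesis B_U : forall i j, B (U i) (U j) = (j == opposite i)%:R.
Hypothesis m_odd : odd m.

Let even_index (i : m.-tuple bool) := ~~ odd (num_ones i).

Lemma even_opposite i : even_index (opposite i) = ~~ even_index i.
Proof. by rewrite /even_index odd_num_ones_opposite. Qed.

Lemma span_plusP X : X \in span_points (Bplus U) ->
  exists a, X = \sum_(i | even_index i) a i *: U i.
Proof.
rewrite /span_points /Bplus big_map big_filter big_enum_cond /=.
case/memv_sumP=> x xU ->.
exists (fun i => coord [tuple U i] ord0 (x i)); apply: eq_bigr => i i_even.
have: x i \in <<[tuple U i]>>%VS by rewrite /= span_seq1 xU.
by move/coord_span => {1}->; rewrite big_ord1.
Qed.

(** The only U i that is not orthogonal to U j has i opposite to j, and this index
    is odd for even j. *)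
Lemma plus_isotropic X j : X \in span_points (Bplus U) -> even_index j ->
  B X (U j) = 0.
Proof.
case/span_plusP=> a ->; rewrite (form_sum_family B_U) even_opposite.
by move->.
Qed.

(** For even j, pairing conj X with U j yields the square of the coefficient of
    U j in X. *)
Lemma plus_conj_nondegenerate (conj : {additive T -> T}) X :
  (forall (c : F) X, conj (c *: X) = c ^+ 2 *: conj X) ->
  (forall i, conj (U i) = U (opposite i)) ->
  X \in span_points (Bplus U) ->
  (forall j, even_index j -> B (conj X) (U j) = 0) -> X = 0.
Proof.
move=> conjZ conjU /span_plusP[a ->] conj0; apply: big1 => j j_even.
have := conj0 j j_even; rewrite raddf_sum.
under eq_bigr do rewrite conjZ conjU.
rewrite form_suml (bigD1 j) //= B_U oppositeK eqxx mulr1 big1 ?addr0.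
  by move=> /eqP; rewrite sqrf_eq0 => /eqP ->; rewrite scale0r.
by move=> i /andP[_ neq]; rewrite B_U oppositeK eq_sym (negPf neq) mulr0.
Qed.

End PlusSpan.

(** Q vanishes on each U i with i even, and these vectors are pairwise orthogonal
    for its polar form B. *)
Lemma quadric_plus (F : fieldType) (m : nat) (T : vectType F) (B : {biscalar T})
    (E U : m.-tuple bool -> T) X :
  odd m ->
  (forall i j, B (E i) (E j) = (j == opposite i)%:R) ->
  (forall i j, B (U i) (U j) = (j == opposite i)%:R) ->
  (forall i, U i \in <<codom_tuple E>>%VS) ->
  (forall i, quadratic_form E (U i) = 0) ->
  X \in span_points (Bplus U) -> quadratic_form E X = 0.
Proof.
move=> m_odd B_E B_U UE QU /(span_plusP)[a ->].
pose good Y := [/\ Y \in <<codom_tuple E>>%VS, quadratic_form E Y = 0 &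
  forall j, ~~ odd (num_ones j) -> B Y (U j) = 0].
suff [] : good (\sum_(i | ~~ odd (num_ones i)) a i *: U i) by [].
apply: big_rec => [|i Y i_even [YE QY BY]].
  split; rewrite ?mem0v //; last by move=> j _; rewrite linear0l.
  have := quadratic_form_comb E 0 0 0 0 (odd_gt0 m_odd).
  by rewrite !scale0r addr0 expr0n !mul0r !addr0.
split; first by rewrite memvD ?memvZ.
  rewrite addrC -[Y]scale1r (quadratic_form_gram B_E) ?odd_gt0 // QY QU BY //.
  by rewrite !mulr0 !addr0.
move=> j j_even; rewrite linearDl linearZl_LR /= B_U BY // addr0.
case: eqVneq => [ij|_]; last exact: mulr0.
by move: j_even; rewrite ij odd_num_ones_opposite // i_even.
Qed.

(** * Conjugation and real points *)

Section Conjugation.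

Variables (F : fieldType) (m : nat) (T : vectType F) (E : m.-tuple bool -> T).
Variable conj : {additive T -> T}.
Hypothesis conjZ : forall (c : F) X, conj (c *: X) = c ^+ 2 *: conj X.
Hypothesis conjE : forall i, conj (E i) = E i.

Lemma conj_expand X : X \in <<codom_tuple E>>%VS ->
  conj X = \sum_i coordinate E i X ^+ 2 *: E i.
Proof.
move=> /coordinate_expand {1}->; rewrite raddf_sum.
by apply: eq_bigr => i _; rewrite conjZ conjE.
Qed.

Lemma memv_conj X :
  X \in <<codom_tuple E>>%VS -> conj X \in <<codom_tuple E>>%VS.
Proof.
move/conj_expand->; apply: memv_suml => i _.
exact/memvZ/memv_family.
Qed.

Lemma quadratic_form_conj X : 2%N \in [pchar F] -> free (codom_tuple E) ->
  X \in <<codom_tuple E>>%VS ->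
  quadratic_form E (conj X) = quadratic_form E X ^+ 2.
Proof.
move=> F2 E_free XE; rewrite (conj_expand XE) /quadratic_form.
rewrite -(pFrobenius_autE F2) rmorph_sum; apply: eq_bigr => i _.
by rewrite !(coordinate_sum _ _ E_free) -exprMn.
Qed.

End Conjugation.

Lemma conj_involutive (F : finFieldType) (m : nat) (T : vectType F)
    (E : m.-tuple bool -> T) (conj : {additive T -> T}) X : #|F| = 4%N ->
  (forall (c : F) X, conj (c *: X) = c ^+ 2 *: conj X) ->
  (forall i, conj (E i) = E i) ->
  X \in <<codom_tuple E>>%VS -> conj (conj X) = X.
Proof.
move=> F4 conjZ conjE XE.
rewrite [RHS](coordinate_expand XE) (conj_expand conjZ conjE XE) raddf_sum.
by apply: eq_bigr => i _; rewrite conjZ conjE (exp4 F4).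
Qed.

Section RealPoints.

Variables (F : fieldType) (F2 : 2%N \in [pchar F]).

(** The inclusion of F_2 in F, through the representatives 0 and 1. *)
Definition embed (c : 'F_2) : F := (c : nat)%:R.

Lemma F2_cases (c : 'F_2) : c = 0 \/ c = 1.
Proof.
by case: c => -[|[|//]] ltc; [left | right]; apply: val_inj.
Qed.

Lemma embedD (c d : 'F_2) : embed (c + d) = embed c + embed d.
Proof.
rewrite /embed.
by case: (F2_cases c) => ->; case: (F2_cases d) => ->;
  rewrite ?add0r ?addr0 //= (addrr_pchar2 F2).
Qed.

Lemma embedM (c d : 'F_2) : embed (c * d) = embed c * embed d.
Proof.
rewrite /embed.
by case: (F2_cases c) => ->; case: (F2_cases d) => ->;
  rewrite ?mul0r ?mulr0 ?mul1r ?mulr1.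
Qed.

Lemma embed_eq0 (c : 'F_2) : (embed c == 0) = (c == 0).
Proof. by case: (F2_cases c) => ->; rewrite ?eqxx //= oner_eq0. Qed.

Variables (TV : vectType 'F_2) (T : vectType F) (iota : {additive TV -> T}).

Lemma additive_scale (c : 'F_2) x : iota (c *: x) = embed c *: iota x.
Proof.
by case: (F2_cases c) => ->; rewrite ?scale0r ?raddf0 // !scale1r.
Qed.

Variables (m : nat) (E0 : m.-tuple bool -> TV) (E : m.-tuple bool -> T).
Hypotheses (E_free : free (codom_tuple E)).
Hypotheses (E0_span : <<codom_tuple E0>>%VS = fullv).
Hypothesis iotaE : forall i, iota (E0 i) = E i.

Lemma real_expand x : iota x = \sum_i embed (coordinate E0 i x) *: E i.
Proof.
have {1}-> : x = \sum_i coordinate E0 i x *: E0 i.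
  by apply: coordinate_expand; rewrite E0_span memvf.
rewrite raddf_sum; apply: eq_bigr => i _.
by rewrite [LHS]additive_scale iotaE.
Qed.

Lemma coordinate_real i x : coordinate E i (iota x) = embed (coordinate E0 i x).
Proof. by rewrite real_expand coordinate_sum. Qed.

Lemma quadratic_form_real x :
  quadratic_form E (iota x) = embed (quadratic_form E0 x).
Proof.
rewrite /quadratic_form (big_morph embed embedD (erefl _)).
by apply: eq_bigr => i _; rewrite embedM !coordinate_real.
Qed.

Lemma real_eq0 x : iota x = 0 -> x = 0.
Proof.
move=> x0; rewrite [LHS](coordinate_expand (E := E0)) ?E0_span ?memvf //.
apply: big1 => i _; have := coordinate_real i x.
rewrite x0 /coordinate linear0 => /esym/eqP; rewrite embed_eq0 => /eqP ->.
by rewrite scale0r.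
Qed.

End RealPoints.

Lemma symplectic_basis (V : vectType 'F_2) (br : {biscalar V})
    (e : bool -> V) : (forall a, br a a = 0) -> br (e false) (e true) = 1 ->
  forall b c, br (e b) (e c) = (b != c)%:R.
Proof.
move=> alt br1 b c.
have br2 : br (e true) (e false) = 1.
  have := alt (e false + e true); rewrite linearDl !linearDr /= !alt br1.
  by rewrite add0r addr0 => /eqP; rewrite addrC addr_eq0 => /eqP->; apply: val_inj.
by case: b; case: c.
Qed.

(** * The lines of the spread *)

Theorem proposition3
  (m : nat) (hm : (2 <= m)%N) (hodd : odd m)
  (* F_4 *)
  (F : finFieldType) (hF : #|F| = 4%N)
  (omega : F) (homega : omega ^+ 2 + omega + 1 = 0)
  (* V_k and its basis *)
  (V : 'I_m -> vectType 'F_2) (hV : forall k, \dim {: V k} = 2%N)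
  (e : forall k, bool -> V k)
  (he : forall k, basis_of {: V k} [:: e k false; e k true])
  (* W_k = F_4 (x) V_k *)
  (W : 'I_m -> vectType F) (iota : forall k, {additive V k -> W k})
  (hiota : forall k, is_scalar_extension (iota k))
  (* TV and TW: the tensor products of the V_k and of the W_k *)
  (TV : vectType 'F_2) (tensV : (forall k, V k) -> TV)
  (hTV : is_tensor_product tensV)
  (TW : vectType F) (tensW : (forall k, W k) -> TW)
  (hTW : is_tensor_product tensW)
  (* the embedding of TV into TW *)
  (iotaT : {additive TV -> TW})
  (hiotaT : forall a : (forall k, V k),
      iotaT (tensV a) = tensW (fun k => iota k (a k)))
  (* complex conjugation *)
  (conj : {additive TW -> TW}) (hconj : is_conjugation iotaT conj)
  (* the symplectic forms, and the bilinear forms on TV and TW *)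
  (br : forall k, {biscalar (V k)})
  (hbr_alt : forall k a, br k a a = 0)
  (hbr_e : forall k, br k (e k false) (e k true) = 1)
  (brV : {biscalar TV})
  (hbrV : forall a b : (forall k, V k),
      brV (tensV a) (tensV b) = \prod_(k < m) br k (a k) (b k))
  (brW : {biscalar TW})
  (hbrW : forall x y : TV, brW (iotaT x) (iotaT y) = (brV x y : nat)%:R) :
  let eW (k : 'I_m) (b : bool) : W k := iota k (e k b) in
  let U := pure_tensor tensW (fun k => u_vec omega (eW k)) in
  let SBplus := span_points (Bplus U) in
  let Q2 := quadratic_form (pure_tensor tensV e) in
  let Q4 := quadratic_form (pure_tensor tensW eW) in
  let H (X : TW) : F := brW (conj X) X in
  forall L : {vspace TW}, in_spread conj SBplus L ->
    (generator Q4 L <-> point_of_variety H (L :&: SBplus)%VS) /\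
    (~ generator Q4 L ->
       bisecant Q4 L /\
       forall x : TV, point_of_variety Q2 <[x]>%VS -> ~ (<[iotaT x]> <= L)%VS).
Proof.
move=> eW U SBplus Q2 Q4 H L [[lineL realL] meetL].
have m_gt0 := odd_gt0 hodd; have F2 := pchar2 hF.
have [conjZ conj_iota] := hconj.
pose E0 := pure_tensor tensV e; pose E := pure_tensor tensW eW.
have iotaE i : iotaT (E0 i) = E i by rewrite hiotaT.
have conjE i : conj (E i) = E i by rewrite -iotaE conj_iota.
have B_E i j : brW (E i) (E j) = (j == opposite i)%:R.
  rewrite -!iotaE hbrW hbrV.
  under eq_bigr do rewrite (symplectic_basis (hbr_alt _) (hbr_e _)).
  by rewrite prod_neq; case: (_ == _).
have E_free := gram_free B_E.
have UE i : U i = frame omega E i.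
  rewrite -[RHS](multilinear_expand hTW.1 (fun k => u_coef omega (tnth i k)) eW).
  congr tensW; apply: functional_extensionality_dep => k.
  by rewrite /u_vec /u_coef scale1r.
have B_U i j : brW (U i) (U j) = (j == opposite i)%:R.
  by rewrite !UE (form_frame hF homega B_E).
have conjU i : conj (U i) = U (opposite i).
  by rewrite !UE (frame_conj omega hF _ conjZ conjE).
have U_span i : U i \in <<codom_tuple E>>%VS by rewrite UE memv_frame.
have Q_U i : Q4 (U i) = 0 by rewrite UE; exact: (quadratic_form_frame omega hF B_E).
have plusE X : X \in SBplus -> X \in <<codom_tuple E>>%VS.
  by case/span_plusP=> a ->; apply: memv_suml => i _; apply: memvZ.
have Q_plus X : X \in SBplus -> Q4 X = 0.
  exact: (quadric_plus hodd B_E B_U U_span Q_U).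
have conj_span X : X \in <<codom_tuple E>>%VS -> conj X \in <<codom_tuple E>>%VS.
  exact: (memv_conj conjZ conjE).
have conjK X : X \in <<codom_tuple E>>%VS -> conj (conj X) = X.
  exact: (conj_involutive hF conjZ conjE).
have conjQ X : X \in <<codom_tuple E>>%VS -> Q4 (conj X) = Q4 X ^+ 2.
  exact: (quadratic_form_conj conjZ conjE F2 E_free).
(* S+ contains no point that is equal to its conjugate. *)
have eq_conj0 X : X \in SBplus -> forall c, conj X = c *: X -> X = 0.
  move=> XS c XX; apply: (plus_conj_nondegenerate B_U conjZ conjU XS) => j j_even.
  by rewrite XX linearZl_LR (plus_isotropic B_U hodd XS) ?mulr0.
(* Q X = 0 and Q (conj X) = (Q X)^2 = 0, so only the polar term survives. *)
have line_at X : X \in SBplus -> X \in L -> X != 0 ->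
    [/\ conj X \in L, conj X \notin <[X]>%VS & forall a b,
      Q4 (a *: X + b *: conj X) = a * b * H X].
  move=> XS XL X0; have XE := plusE X XS; split.
  - by apply/realL; exists X.
  - by apply: contraNN X0 => /vlineP[c /(eq_conj0 X XS)] ->.
  move=> a b; rewrite addrC /Q4 (quadratic_form_gram B_E) ?conj_span //.
  by rewrite -/Q4 conjQ // Q_plus // expr0n !mulr0 !add0r [b * a]mulrC.
have plus_meet X : X \in SBplus -> X \in L -> X != 0 ->
    (L :&: SBplus)%VS = <[X]>%VS.
  move=> XS XL X0; have [cXL cX_X _] := line_at X XS XL X0.
  apply: subv_anti; apply/andP; split; last by rewrite subv_cap -!memvE XL.
  apply/subvP=> Z; rewrite memv_cap => /andP[ZL ZS].
  have [a [b ZE]] := line_span X0 cX_X lineL XL cXL ZL.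
  case: (eqVneq b 0) => [b0|b0].
    by apply/vlineP; exists a; rewrite ZE b0 scale0r addr0.
  case/eqP: X0; apply: (plus_conj_nondegenerate B_U conjZ conjU XS) => j j_even.
  have := plus_isotropic B_U hodd ZS j_even.
  rewrite ZE linearDl !linearZl_LR /= (plus_isotropic B_U hodd XS) //.
  by rewrite mulr0 add0r => /eqP; rewrite mulf_eq0 (negPf b0) => /eqP.
have [X [X0 XL XS]] : exists X, [/\ X != 0, X \in L & X \in SBplus].
  exists (vpick (L :&: SBplus)); rewrite vpick0 meetL.
  by have := memv_pick (L :&: SBplus)%VS; rewrite memv_cap => /andP[].
have [cXL cX_X QE] := line_at X XS XL X0; rewrite (plus_meet X XS XL X0).
have cX0 : conj X != 0 by apply: contraNneq cX_X => ->; rewrite mem0v.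
have H_hom c Y : H (c *: Y) = c ^+ 3 * H Y.
  by rewrite /H conjZ linearZl_LR linearZr_LR /= mulrA -exprSr.
have gen_H := generator_hyperbolic X0 cX_X lineL XL cXL QE.
split; first by split=> [/gen_H HX|/(point_of_homogeneous X H_hom)[_ /gen_H]] //;
  exists X.
move=> /gen_H/eqP HX; have pts := hyperbolic_points X0 cX_X lineL XL cXL QE HX.
split.
  split=> //; exists <[X]>%VS, <[conj X]>%VS; split=> // XcX.
  by rewrite XcX memv_line in cX_X.
have E0_span := tensor_product_span hTV he.
have Q2_hom c x : Q2 (c *: x) = c ^+ 2 * Q2 x.
  rewrite -[c *: x]addr0 -(scale0r x) /Q2 quadratic_form_comb //.
  by rewrite expr0n mul0r mulr0 mul0r !addr0.
move=> x /(point_of_homogeneous x Q2_hom)[x0 Q2x] xL.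
have ix0 : iotaT x != 0.
  by apply: contraNneq x0 => /(real_eq0 E_free E0_span iotaE) ->.
have Q4x : Q4 (iotaT x) = 0.
  by rewrite /Q4 (quadratic_form_real F2 E_free E0_span iotaE) -/E0 -/Q2 Q2x.
(* A real vector in S+ is its own conjugate, hence 0. *)
have not_plus c Y : Y \in SBplus -> iotaT x != c *: Y.
  move=> YS; apply: contraNneq ix0 => xY; have xS : iotaT x \in SBplus.
    by rewrite xY memvZ.
  by rewrite (eq_conj0 _ xS 1) // conj_iota scale1r.
have [] : <[iotaT x]>%VS = <[X]>%VS \/ <[iotaT x]>%VS = <[conj X]>%VS.
  by apply/pts; split=> //; exists (iotaT x).
  by case/(eq_vline ix0)=> c _ /eqP; rewrite (negPf (not_plus c X XS)).
case/(eq_vline ix0)=> c _ xcX; have := not_plus (c ^+ 2) X XS.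
by rewrite -(conjK X) ?plusE // -conjZ -xcX conj_iota eqxx.
Qed.
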